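(* Let $\ell\subset\mathsf{H}^2$ be a geodesic, and let $\mathbf{s}_t$ be a path of unit-spacelike vectors parametrizing the leaves of the foliation of $\mathsf{H}^2$ by the geodesics orthogonal to $\ell$. Let $p_t$, $a\le t\le b$, be a regular path in $\mathsf{E}$ such that $p_t'$ belongs to the interior of the translational semigroup $\mathsf{V}(\mathcal{H}(\mathbf{s}_t))$. Then for every $t_1\neq t_2$ with $a\le t_1,t_2\le b$, the crooked planes $\mathcal{C}(p_{t_1},\mathbf{s}_{t_1})$ and $\mathcal{C}(p_{t_2},\mathbf{s}_{t_2})$ are disjoint.
   Context: $\mathsf{V}$ is an oriented real $3$-dimensional vector space with an inner product $\mathbf{u}\cdot\mathbf{v}$ of signature $(2,1)$ and a chosen time-orientation: one of the two components of the set of timelike vectors ($\mathbf{v}\cdot\mathbf{v}<0$) is selected and called $\mathsf{Future}$. A nonzero non-spacelike vector is future-pointing if it lies in the closure of $\mathsf{Future}$. $\mathsf{E}$ (Minkowski space) is an affine space with group of translations $\mathsf{V}$. A vector $\mathbf{s}$ is unit-spacelike if $\mathbf{s}\cdot\mathbf{s}=1$. For such $\mathbf{s}$, $\mathbf{s}^-,\mathbf{s}^+\in\mathbf{s}^\perp$ denote future-pointing null vectors with $\mathbf{s}^-\cdot\mathbf{s}^+=-1$ such that $(\mathbf{s},\mathbf{s}^-,\mathbf{s}^+)$ is a positively oriented basis of $\mathsf{V}$. For $p\in\mathsf{E}$ and $\mathbf{s}$ unit-spacelike, the (open) crooked halfspace with vertex $p$ and director $\mathbf{s}$ is $$\mathcal{H}(p,\mathbf{s})=\{q: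 (q-p)\cdot\mathbf{s}^+<0,\ (q-p)\cdot\mathbf{s}>0\}\cup\{q:(q-p)\cdot\mathbf{s}^+<0,\ (q-p)\cdot\mathbf{s}^->0,\ (q-p)\cdot\mathbf{s}=0\}\cup\{q:(q-p)\cdot\mathbf{s}^->0,\ (q-p)\cdot\mathbf{s}<0\}.$$ The crooked plane $\mathcal{C}(p,\mathbf{s})$ is its boundary $\partial\mathcal{H}(p,\mathbf{s})$. The translational semigroup of a crooked halfspace $\mathcal{H}$ is $\mathsf{V}(\mathcal{H})=\{\mathbf{v}\in\mathsf{V}:\mathcal{H}+\mathbf{v}\subset\mathcal{H}\}$. For $\mathcal{H}=\mathcal{H}(p,\mathbf{s})$ it does not depend on $p$ and is written $\mathsf{V}(\mathcal{H}(\mathbf{s}))$; it is the $2$-dimensional cone of nonnegative linear combinations of $\mathbf{s}^-$ and $-\mathbf{s}^+$, and its interior means its interior within the plane it spans (positive linear combinations). The hyperbolic plane is $\mathsf{H}^2=\{\mathbf{v}\in\mathsf{Future}:\mathbf{v}\cdot\mathbf{v}=-1\}$; the geodesic corresponding to a spacelike vector $\mathbf{s}$ is $\mathsf{H}^2\cap\mathbf{s}^\perp$. That $\mathbf{s}_t$ parametrizes the leaves means that $\mathbf{s}_t$ depends continuously on $t$, that each geodesic $\mathsf{H}^2\cap\mathbf{s}_t^\perp$ is orthogonal to $\ell$, and that different values of $t$ give different geodesics.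
   Formalization: The claim fails when the leaves move away from the side to which s_t points; the formal statement adds that for t<t' in [a,b] the half-plane {v in H^2 : v·s_t'>0} is contained in {v in H^2 : v·s_t>0}, excluding exactly that direction. *)

(* Defs.v *)
From HB Require Import structures.
From mathcomp Require Import all_boot all_order all_algebra.
From mathcomp Require Import all_classical all_reals all_analysis.
Import Order.TTheory GRing.Theory Num.Theory.
Import numFieldNormedType.Exports.

Set Implicit Arguments.
Unset Strict Implicit.
Unset Printing Implicit Defensive.

Local Open Scope classical_set_scope.
Local Open Scope ring_scope.

(* The norm of V only provides the usual topology of a finite-dimensional real
   vector space; it is unrelated to the Lorentzian inner product [mdot].
   The orientation is represented by a nonzero alternating trilinear form,
   only the sign of which is used. *)
Record minkowskiVect (R : realType) (V : normedModType R) := MinkowskiVect {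
  mdot : {symmetric V} ;
  mdot_signature : exists e1 e2 e3 : V,
    [/\ mdot e1 e1 = 1, mdot e2 e2 = 1 & mdot e3 e3 = -1] /\
    [/\ mdot e1 e2 = 0, mdot e1 e3 = 0 & mdot e2 e3 = 0] /\
    (forall v : V, exists x y z : R, v = x *: e1 + y *: e2 + z *: e3) ;
  mvol : V -> V -> V -> R ;
  mvol_linear1 : forall v w, scalar (fun u => mvol u v w) ;
  mvol_linear2 : forall u w, scalar (fun v => mvol u v w) ;
  mvol_linear3 : forall u v, scalar (fun w => mvol u v w) ;
  mvol_alt12 : forall u w, mvol u u w = 0 ;
  mvol_alt23 : forall u v, mvol u v v = 0 ;
  mvol_neq0 : exists u v w, mvol u v w != 0 ;
  Future : set V ;
  Future_component : exists2 v0 : V, mdot v0 v0 < 0 &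
    Future = connected_component [set v | mdot v v < 0] v0
}.

Record affineSpace (V : zmodType) := AffineSpace {
  point :> Type ;
  translate : point -> V -> point ;
  difference : point -> point -> V ;
  translateD : forall p u v,
    translate p (u + v) = translate (translate p u) v ;
  translateK : forall p v, difference (translate p v) p = v ;
  differenceK : forall p q, translate p (difference q p) = q
}.

Section LinearNotions.
Variables (R : realType) (V : normedModType R).

Definition lin_span (A : set V) : set V :=
  [set w | exists (n : nat) (c : 'I_n -> R) (x : 'I_n -> V),
     (forall i, A (x i)) /\ w = \sum_i c i *: x i].

Definition rel_interior (A : set V) : set V :=
  [set v | A v /\ within (lin_span A) (nbhs v) A].

Variable E : affineSpace V.
Implicit Types A : set E.

(* Boundary for the topology of E that makes every chart
   [v |-> translate q v] a homeomorphism, read in the chart centred at q. *)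
Definition affine_boundary A : set E :=
  [set q | closure [set v | A (translate q v)] 0 /\
           ~ interior [set v | A (translate q v)] 0].

Definition translational_semigroup A : set V :=
  [set v | forall q, A q -> A (translate q v)].

(* [dp] is the (one-sided at the endpoints) derivative of p on [a, b]. *)
Definition regular_path (a b : R) (p : R -> E) (dp : R -> V) : Prop :=
  [/\ forall t, t \in `[a, b] ->
        (fun u => (u - t)^-1 *: difference (p u) (p t))
          @ within `[a, b]%classic t^' --> dp t,
      {within `[a, b]%classic, continuous dp} &
      forall t, t \in `[a, b] -> dp t != 0].

End LinearNotions.

Section MinkowskiNotions.
Variables (R : realType) (V : normedModType R) (M : minkowskiVect V).

Let dot (u v : V) : R := mdot M u v.

Definition spacelike (v : V) : Prop := 0 < dot v v.

Definition unit_spacelike (s : V) : Prop := dot s s = 1.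

Definition future_pointing (v : V) : Prop :=
  [/\ v != 0, dot v v <= 0 & closure (Future M) v].

(* The pair (s^-, s^+), which is unique up to (s^-, s^+) |-> (c s^-, c^-1 s^+)
   with c > 0. *)
Definition null_frame (s sm sp : V) : Prop :=
  [/\ dot sm s = 0 /\ dot sp s = 0,
      dot sm sm = 0 /\ dot sp sp = 0,
      future_pointing sm /\ future_pointing sp,
      dot sm sp = -1 &
      0 < mvol M s sm sp].

(* The three conditions are invariant under the rescaling of (s^-, s^+), so
   any choice of null frame gives the same set. *)
Definition crooked_halfspace (E : affineSpace V) (p : E) (s : V) : set E :=
  [set q | exists sm sp : V, null_frame s sm sp /\
     let v := difference q p in
     [\/ dot v sp < 0 /\ 0 < dot v s,
         [/\ dot v sp < 0, 0 < dot v sm & dot v s = 0] |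
         0 < dot v sm /\ dot v s < 0]].

Definition crooked_plane (E : affineSpace V) (p : E) (s : V) : set E :=
  affine_boundary (crooked_halfspace p s).

Definition hyperbolic_plane : set V :=
  [set v | Future M v /\ dot v v = -1].

Definition geodesic (s : V) : set V :=
  [set v | hyperbolic_plane v /\ dot v s = 0].

Definition is_geodesic (l : set V) : Prop :=
  exists2 s, spacelike s & l = geodesic s.

(* Tangent line at x to the geodesic l: the intersection of the plane
   containing l with the tangent plane x^perp of the hyperbolic plane. *)
Definition tangent_line (l : set V) (x : V) : set V :=
  [set u | exists s,
     [/\ spacelike s, l = geodesic s, dot u s = 0 & dot u x = 0]].

Definition orthogonal_geodesics (l m : set V) : Prop :=
  exists x, [/\ l x, m x &
    forall u v, tangent_line l x u -> tangent_line m x v -> dot u v = 0].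

Definition parametrizes_leaves (l : set V) (a b : R) (s : R -> V) : Prop :=
  [/\ forall t, t \in `[a, b] -> unit_spacelike (s t),
      {within `[a, b]%classic, continuous s},
      forall t, t \in `[a, b] -> orthogonal_geodesics l (geodesic (s t)) &
      forall t t', t \in `[a, b] -> t' \in `[a, b] -> t != t' ->
        geodesic (s t) <> geodesic (s t')].

Definition half_plane (s : V) : set V :=
  [set v | hyperbolic_plane v /\ 0 < dot v s].

(* The leaves move to the side towards which [s t] points. If they move to the
   other side, the crooked planes can meet. Take the form
   x x' + y y' - z z', the constant velocity p' = (0, -c, 0) or (0, c, 0)
   according to the orientation, with c > 0, and
   s t = (cosh t, 0, - sinh t): at the parameters 0 and t > 0 both crooked
   planes contain p 0 + (- c t tanh t, 0, c t) + t p'. *)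
Definition points_along (a b : R) (s : R -> V) : Prop :=
  forall t t', t \in `[a, b] -> t' \in `[a, b] -> t < t' ->
    half_plane (s t') `<=` half_plane (s t).

End MinkowskiNotions.

(* Main.v *)
Require Import Defs.
From HB Require Import structures.
From mathcomp Require Import all_boot all_order all_algebra.
From mathcomp Require Import all_classical all_reals all_analysis.
From mathcomp Require Import ring lra.
Import Order.TTheory GRing.Theory Num.Theory.
Import numFieldNormedType.Exports.
Local Open Scope classical_set_scope.
Local Open Scope ring_scope.

Set Implicit Arguments.
Unset Strict Implicit.
Unset Printing Implicit Defensive.

(* Let e be a unit normal of l and x_t the point where the leaf of s_t meets l.
   Then (s_t, e, x_t) is a Lorentz-orthonormal frame, e being fixed (up to
   sign, by the orientation), and s_t^-, s_t^+ are proportional to x_t + e and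
   x_t - e. Hence, with w = q - p_t, X = w.s_t, U = w.x_t and y = w.e, the
   crooked plane consists of points with y = g U for some g in [-1, 1] such
   that g X = |X|, and p_t' lies in the interior of the translational semigroup
   when p_t'.s_t = 0 and |p_t'.x_t| < p_t'.e.
   In the frame at t_1, s_t = cosh r s_{t1} + sinh r x_{t1} with r nondecreasing
   because the leaves move towards s_t. Superadditivity of sinh gives
     |p_t'.s_{t1}| + |p_t'.s_{t2}| < sinh r_{t2} (p_t'.e)
   for t in [t_1, t_2]. This is a conjunction of four linear inequalities, so it
   passes to the displacement d = p_{t2} - p_{t1}. On the other hand, a common
   point of the two crooked planes would give
     sinh r_{t2} (d.e) <= |d.s_{t1}| + |d.s_{t2}|. *)

(** * Lorentz frames *)

Section LorentzAlgebra.
Variables (R : realType) (V : normedModType R) (M : minkowskiVect V).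
Local Notation dot := (mdot M).
Implicit Types u v w : V.

Lemma mdotC u v : dot u v = dot v u.
Proof. by rewrite (@hermitian_subproof _ _ _ _ (mdot M)) expr0 mul1r. Qed.

Lemma mdotDr u v w : dot u (v + w) = dot u v + dot u w.
Proof. exact: linearD. Qed.

Lemma mdotZr c u v : dot u (c *: v) = c * dot u v.
Proof. exact: linearZ. Qed.

Lemma mdotDl u v w : dot (u + v) w = dot u w + dot v w.
Proof. by rewrite !(mdotC _ w) mdotDr. Qed.

Lemma mdotZl c u v : dot (c *: u) v = c * dot u v.
Proof. by rewrite !(mdotC _ v) mdotZr. Qed.

Lemma mdotNr u v : dot u (- v) = - dot u v.
Proof. by rewrite -scaleN1r mdotZr mulN1r. Qed.

Lemma mdotNl u v : dot (- u) v = - dot u v.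
Proof. by rewrite !(mdotC _ v) mdotNr. Qed.

Lemma mdot0r u : dot u 0 = 0.
Proof. by rewrite -(scale0r 0) mdotZr mul0r. Qed.

Definition mdotE := (mdotDl, mdotDr, mdotZl, mdotZr, mdotNl, mdotNr).

Definition lorentz_frame e1 e2 e3 : Prop :=
  [/\ dot e1 e1 = 1, dot e2 e2 = 1 & dot e3 e3 = -1] /\
  [/\ dot e1 e2 = 0, dot e1 e3 = 0 & dot e2 e3 = 0].

Lemma mdot_comb e1 e2 e3 (x y z x' y' z' : R) : lorentz_frame e1 e2 e3 ->
  dot (x *: e1 + y *: e2 + z *: e3) (x' *: e1 + y' *: e2 + z' *: e3)
    = x * x' + y * y' - z * z'.
Proof.
move=> [[h11 h22 h33] [h12 h13 h23]].
rewrite !mdotE.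
rewrite [dot e2 e1]mdotC [dot e3 e1]mdotC [dot e3 e2]mdotC.
by rewrite h11 h22 h33 h12 h13 h23; ring.
Qed.

(** The Gram determinant of an orthonormal triple is -1, so the triple is a basis and the form is
    nondegenerate. *)
Lemma lorentz_frame_eq0 e1 e2 e3 w : lorentz_frame e1 e2 e3 ->
  dot w e1 = 0 -> dot w e2 = 0 -> dot w e3 = 0 -> w = 0.
Proof.
case: (mdot_signature M) => f1 [f2 [f3 [f11 [f12 fS]]]].
have fO : lorentz_frame f1 f2 f3 by [].
have [x1 [y1 [z1 ->]]] := fS e1; have [x2 [y2 [z2 ->]]] := fS e2.
have [x3 [y3 [z3 ->]]] := fS e3; have [x [y [z ->]]] := fS w.
rewrite /lorentz_frame !(mdot_comb _ _ _ _ _ _ fO).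
move=> [[h11 h22 h33] [h12 h13 h23]] h1 h2 h3.
(* Cramer's rule; [D ^+ 2] is minus the Gram determinant of e1, e2, e3. *)
pose D := x1 * (y2 * z3 - y3 * z2) - y1 * (x2 * z3 - x3 * z2)
  + z1 * (x2 * y3 - x3 * y2).
have D2 : D ^+ 2 = 1.
  have -> : D ^+ 2 = - ((x1 * x1 + y1 * y1 - z1 * z1)
      * ((x2 * x2 + y2 * y2 - z2 * z2) * (x3 * x3 + y3 * y3 - z3 * z3)
        - (x2 * x3 + y2 * y3 - z2 * z3) ^+ 2)
    - (x1 * x2 + y1 * y2 - z1 * z2)
      * ((x1 * x2 + y1 * y2 - z1 * z2) * (x3 * x3 + y3 * y3 - z3 * z3)
        - (x2 * x3 + y2 * y3 - z2 * z3) * (x1 * x3 + y1 * y3 - z1 * z3))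
    + (x1 * x3 + y1 * y3 - z1 * z3)
      * ((x1 * x2 + y1 * y2 - z1 * z2) * (x2 * x3 + y2 * y3 - z2 * z3)
        - (x2 * x2 + y2 * y2 - z2 * z2) * (x1 * x3 + y1 * y3 - z1 * z3))).
    by rewrite /D; ring.
  by rewrite h11 h22 h33 h12 h13 h23; ring.
have D0 : D != 0.
  apply/eqP => D0; move: D2; rewrite D0 expr0n /= => /eqP.
  by rewrite eq_sym oner_eq0.
have Dx : D * x = 0.
  have -> : D * x = (x * x1 + y * y1 - z * z1) * (y2 * z3 - y3 * z2)
    + (x * x2 + y * y2 - z * z2) * (y3 * z1 - y1 * z3)
    + (x * x3 + y * y3 - z * z3) * (y1 * z2 - y2 * z1).
    by rewrite /D; ring.
  by rewrite h1 h2 h3 !mul0r !addr0.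
have Dy : D * y = 0.
  have -> : D * y = (x * x1 + y * y1 - z * z1) * (x3 * z2 - x2 * z3)
    + (x * x2 + y * y2 - z * z2) * (x1 * z3 - x3 * z1)
    + (x * x3 + y * y3 - z * z3) * (x2 * z1 - x1 * z2).
    by rewrite /D; ring.
  by rewrite h1 h2 h3 !mul0r !addr0.
have Dz : D * z = 0.
  have -> : D * z = (x * x1 + y * y1 - z * z1) * (x3 * y2 - x2 * y3)
    + (x * x2 + y * y2 - z * z2) * (x1 * y3 - x3 * y1)
    + (x * x3 + y * y3 - z * z3) * (x2 * y1 - x1 * y2).
    by rewrite /D; ring.
  by rewrite h1 h2 h3 !mul0r !addr0.
move: Dx Dy Dz => /eqP + /eqP + /eqP.
rewrite !mulf_eq0 !(negPf D0) /= => /eqP -> /eqP -> /eqP ->.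
by rewrite !scale0r !addr0.
Qed.

Lemma lorentz_frame_ext e1 e2 e3 u v : lorentz_frame e1 e2 e3 ->
  dot u e1 = dot v e1 -> dot u e2 = dot v e2 -> dot u e3 = dot v e3 -> u = v.
Proof.
move=> eO h1 h2 h3; apply/eqP; rewrite -subr_eq0; apply/eqP.
by apply: (lorentz_frame_eq0 eO); rewrite !mdotE ?h1 ?h2 ?h3 subrr.
Qed.

Lemma lorentz_frame_decomp e1 e2 e3 v : lorentz_frame e1 e2 e3 ->
  v = dot v e1 *: e1 + dot v e2 *: e2 + (- dot v e3) *: e3.
Proof.
move=> eO; apply: (lorentz_frame_ext eO); move: eO => [[h11 h22 h33] [h12 h13 h23]];
  rewrite !mdotE ?h11 ?h22 ?h33 ?h12 ?h13 ?h23
  ?[dot e2 e1]mdotC ?[dot e3 e1]mdotC ?[dot e3 e2]mdotC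
  ?h12 ?h13 ?h23; ring.
Qed.

Lemma mdot_coord e1 e2 e3 u v : lorentz_frame e1 e2 e3 ->
  dot u v = dot u e1 * dot v e1 + dot u e2 * dot v e2 - dot u e3 * dot v e3.
Proof.
move=> eO; rewrite {1}(lorentz_frame_decomp u eO) {1}(lorentz_frame_decomp v eO).
by rewrite (mdot_comb _ _ _ _ _ _ eO); ring.
Qed.

(** [c] and [c'] are the Lorentzian cross products of [u] and [u'] with [v], and the last equation
    is Lagrange's identity. They are tangent at [v] to the geodesics normal to [u] and [u']. *)
Lemma cross_products u u' v : exists c c' : V,
  [/\ dot c u = 0, dot c v = 0, dot c' u' = 0, dot c' v = 0 &
     dot c c' = dot u v * dot u' v - dot u u' * dot v v].
Proof.
case: (mdot_signature M) => f1 [f2 [f3 [f11 [f12 fS]]]].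
have fO : lorentz_frame f1 f2 f3 by [].
have [x1 [y1 [z1 ->]]] := fS u; have [x2 [y2 [z2 ->]]] := fS v.
have [x3 [y3 [z3 ->]]] := fS u'.
exists ((y1 * z2 - y2 * z1) *: f1 + (z1 * x2 - z2 * x1) *: f2
  + (x2 * y1 - x1 * y2) *: f3).
exists ((y3 * z2 - y2 * z3) *: f1 + (z3 * x2 - z2 * x3) *: f2
  + (x2 * y3 - x3 * y2) *: f3).
by split; rewrite !(mdot_comb _ _ _ _ _ _ fO); ring.
Qed.

End LorentzAlgebra.

(** * Continuity of the Lorentzian product and the future cone *)

(** The supremum of the points of [[z, y]] where [h] is at least [h z] cannot lie before [y]: the
    local condition shows that it is attained, then that it can be exceeded. Taking [z] slightly
    after [x] makes the final inequality strict. *)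
Lemma locally_increasing (R : realType) (h : R -> R) (x y : R) : x < y ->
  (forall t, t \in `[x, y] -> exists2 e, 0 < e & forall u, u \in `[x, y] ->
     u != t -> `|u - t| < e -> 0 < (h u - h t) * (u - t)) ->
  h x < h y.
Proof.
move=> xy hinc.
have [e e0 he] : exists2 e, 0 < e & forall u, u \in `[x, y] ->
     u != x -> `|u - x| < e -> 0 < (h u - h x) * (u - x).
  by apply: hinc; rewrite in_itv /= lexx ltW.
pose z := x + Num.min (e / 2) (y - x).
have m0 : 0 < Num.min (e / 2) (y - x) by rewrite lt_min; apply/andP; split; lra.
have zx : x < z by rewrite /z; lra.
have zy : z <= y by rewrite -lerBrDl ge_min lexx orbT.
have hz : h x < h z.
  have : 0 < (h z - h x) * (z - x).
    apply: he; first by rewrite in_itv /= zy ltW.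
      by rewrite gt_eqF.
    rewrite /z [x + _]addrC addrK gtr0_norm//.
    by apply: (@le_lt_trans _ _ (e / 2)); [rewrite ge_min lexx|lra].
  by rewrite pmulr_lgt0 subr_gt0.
apply: lt_le_trans hz _.
pose S := [set u | z <= u <= y /\ h z <= h u].
have Sz : S z by rewrite /S /= lexx.
have Sub : ubound S y by move=> u [/andP[]].
have hS : has_sup S by split; [exists z|exists y].
pose c := sup S.
have zc : z <= c by apply: ub_le_sup => //; exists y.
have cy : c <= y by apply: ge_sup => //; exists z.
have cxy : c \in `[x, y] by rewrite in_itv /=; apply/andP; split; lra.
have [d d0 hd] := hinc c cxy.
have hc : h z <= h c.
  have [u Su uc] := sup_adherent d0 hS; rewrite -/c in uc.
  have uc' : u <= c by apply: ub_le_sup Su; exists y.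
  have [/andP[zu uy] hu] := Su.
  have [<-//|ucN] := eqVneq u c.
  have ltuc : u < c by rewrite lt_neqAle ucN.
  have : 0 < (h u - h c) * (u - c).
    apply: hd => //; first by rewrite in_itv /=; apply/andP; split; lra.
    by rewrite ltr0_norm; lra.
  rewrite nmulr_lgt0 ?subr_lt0//; lra.
move: cy; rewrite le_eqVlt => /predU1P[<-//|cy].
pose w := c + Num.min (d / 2) (y - c).
have m1 : 0 < Num.min (d / 2) (y - c) by rewrite lt_min; apply/andP; split; lra.
have cw : c < w by rewrite /w; lra.
have wy : w <= y by rewrite -lerBrDl ge_min lexx orbT.
have hw : h c < h w.
  have : 0 < (h w - h c) * (w - c).
    apply: hd; first by rewrite in_itv /=; apply/andP; split; lra.
      by rewrite gt_eqF.
    rewrite /w [c + _]addrC addrK gtr0_norm//.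
    by apply: (@le_lt_trans _ _ (d / 2)); [rewrite ge_min lexx|lra].
  by rewrite pmulr_lgt0 subr_gt0.
have : w <= c.
  apply: ub_le_sup; first by exists y.
  by split; [apply/andP; split; lra|lra].
lra.
Qed.

(* The bound is the minimum of [`|f x|] on the compact unit sphere. *)
Lemma linear_injective_bounded_below (R : realType) (n : nat)
    (V : normedModType R) (f : {linear 'rV[R]_n -> V}) :
  injective f -> continuous f ->
  exists2 k : R, 0 < k & forall x, k * `|x| <= `|f x|.
Proof.
move=> finj fcont.
have cnorm (W : normedModType R) : continuous (fun w : W => `|w|).
  by move=> w; exact: norm_continuous.
pose S := [set x : 'rV[R]_n | `|x| = 1].
have [S0|/nonemptyPn S0] := pselect (S !=set0); last first.
  exists 1 => // x; have [->|x0] := eqVneq x 0; first by rewrite normr0 mulr0.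
  have : S (`|x|^-1 *: x).
    by rewrite /S /= normrZ normfV normr_id mulVf// normr_eq0.
  by rewrite S0.
have cS : compact S.
  apply: bounded_closed_compact.
    exists 1; split; first by rewrite num_real.
    by move=> y y1 x /= ->; exact: ltW.
  rewrite (_ : S = (fun x => `|x|) @^-1` [set 1 : R])//.
  by apply: closed_comp => [x _|]; [exact: cnorm|exact: closed_eq].
have [c cSc minc] := @compact_EVT_min _ R (fun x => `|f x|) S S0 cS
  (continuous_subspaceT (fun x => continuous_comp (fcont x) (@cnorm V (f x)))).
move: cSc; rewrite inE => c1.
have c0 : c != 0 by rewrite -normr_gt0 c1.
exists `|f c|.
  rewrite normr_gt0; apply/eqP => fc0; move/eqP: c0; apply.
  by apply: finj; rewrite fc0 linear0.
move=> x; have [->|x0] := eqVneq x 0; first by rewrite normr0 mulr0.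
have nx : 0 < `|x| by rewrite normr_gt0.
have : `|f c| <= `|f (`|x|^-1 *: x)|.
  by apply: minc; rewrite inE /S /= normrZ normfV normr_id mulVf// normr_eq0.
by rewrite linearZ /= normrZ normfV normr_id mulrC ler_pdivlMr.
Qed.

(** Cauchy-Schwarz in the first two coordinates gives [|a1 * b1 + a2 * b2| < |a3 * b3|], so the
    third coordinates decide the sign. The bound on [a] is weak in order to cover null vectors. *)
Lemma reverse_Cauchy_Schwarz (R : realFieldType) (a1 a2 a3 b1 b2 b3 : R) :
  a1 * a1 + a2 * a2 - a3 * a3 <= 0 -> b1 * b1 + b2 * b2 - b3 * b3 < 0 ->
  a3 != 0 ->
  (a1 * b1 + a2 * b2 - a3 * b3 < 0) = (0 < a3 * b3).
Proof.
move=> ha hb a30.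
have b30 : b3 != 0 by apply/eqP => b30; move: hb; rewrite b30; nra.
have a3p : 0 < a3 * a3 by rewrite -expr2 exprn_even_gt0.
have key : (a1 * b1 + a2 * b2) ^+ 2 < (a3 * b3) ^+ 2.
  have h : (a1 * b1 + a2 * b2) ^+ 2 <= (a1 * a1 + a2 * a2) * (b1 * b1 + b2 * b2).
    have := sqr_ge0 (a1 * b2 - a2 * b1); lra.
  apply: (le_lt_trans h); apply: (@le_lt_trans _ _ (a3 * a3 * (b1 * b1 + b2 * b2))).
    rewrite ler_wpM2r; [done|by rewrite addr_ge0// -expr2 sqr_ge0|lra].
  by rewrite exprMn !expr2 ltr_pM2l//; lra.
have : `|a1 * b1 + a2 * b2| < `|a3 * b3|.
  by rewrite -(@ltr_pXn2r _ 2)// ?nnegrE ?normr_ge0// !real_normK ?num_real.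
rewrite ltr_norml => /andP[h1 h2].
have [h|h] := ltP 0 (a3 * b3); first by rewrite gtr0_norm// in h1 h2; lra.
apply/negbTE; rewrite -leNgt; rewrite ler0_norm// in h1 h2; lra.
Qed.

Section LorentzTopology.
Variables (R : realType) (V : normedModType R) (M : minkowskiVect V).
Local Notation dot := (mdot M).
Implicit Types u v w : V.

(** The norm is unrelated to the form, so continuity comes from finite dimension: the coordinate
    parametrization [f] is injective, hence bounded below, which bounds the coordinates [X v] and
    then [dot v u]. *)
Lemma mdot_continuous u : continuous (fun v => dot v u).
Proof.
case: (mdot_signature M) => f1 [f2 [f3 [f11 [f12 fS]]]].
have fO : lorentz_frame M f1 f2 f3 by [].
pose F (x : 'rV[R]_3) :=
  x ord0 ord0 *: f1 + x ord0 (inord 1) *: f2 + x ord0 (inord 2) *: f3.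
have Flin : linear F.
  move=> k x y; rewrite /F !mxE !scalerDl !scalerDr !scalerA.
  by rewrite [RHS]addrACA [X in _ = X + _]addrACA.
pose FL := GRing.isLinear.Build R _ _ _ F Flin.
pose f : {linear 'rV[R]_3 -> V} := HB.pack F FL.
have fcont : continuous f.
  have Zcont i (w : V) : continuous (fun x : 'rV[R]_3 => x ord0 i *: w).
    by move=> x; have c := @coord_continuous R 1 3 ord0 i x; exact: (cvgZr_tmp c).
  by move=> x; exact: (cvgD (cvgD (Zcont _ _ x) (Zcont _ _ x)) (Zcont _ _ x)).
pose X (v : V) : 'rV[R]_3 :=
  \row_(i < 3) [:: dot v f1; dot v f2; - dot v f3]`_i.
have XK v : f (X v) = v.
  by rewrite [RHS](lorentz_frame_decomp v fO) /= /F !mxE /= !inordK.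
have finj : injective f.
  apply: (can_inj (g := X)) => x; apply/rowP => i; rewrite mxE.
  have [[h11 h22 h33] [h12 h13 h23]] := fO.
  case: i => [[|[|[|//]]] hi] /=; rewrite /F !mdotE ?h11 ?h22 ?h33 ?h12 ?h13 ?h23
    ?[dot f2 f1]mdotC ?[dot f3 f1]mdotC ?[dot f3 f2]mdotC ?h12 ?h13 ?h23
    ?mulr0 ?mulr1 ?mulrN1 ?add0r ?addr0 ?opprK ?oppr0;
    by congr (x _ _); apply/val_inj; rewrite /= ?inordK.
have [k k0 hk] := linear_injective_bounded_below finj fcont.
have coord v i : `|X v ord0 i| <= k^-1 * `|v|.
  rewrite ler_pdivlMl// -{2}(XK v); apply: le_trans (hk _).
  rewrite ler_pM2l// [leRHS]/Num.norm /= mx_normrE.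
  exact: (le_bigmax _ (fun ij => `|X v ij.1 ij.2|) (ord0, i)).
have flin : linear (fun v => dot v u : R) by move=> c x y; rewrite mdotDl mdotZl.
pose GL := GRing.isLinear.Build R _ _ _ (fun v => dot v u : R) flin.
pose g : {linear V -> R} := HB.pack (fun v => dot v u : R) GL.
have gb (v : V) : `|g v| <= k^-1 * (`|dot f1 u| + `|dot f2 u| + `|dot f3 u|) * `|v|.
  rewrite -{1}(XK v) /g /= /F !mdotE.
  have m i (z : R) : `|X v ord0 i * z| <= k^-1 * `|v| * `|z|.
    by rewrite normrM ler_wpM2r.
  apply: (le_trans (ler_normD _ _)).
  apply: (@le_trans _ _ (k^-1 * `|v| * `|dot f1 u| + k^-1 * `|v| * `|dot f2 u|
    + k^-1 * `|v| * `|dot f3 u|)).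
    by apply: lerD => //; apply: (le_trans (ler_normD _ _)); apply: lerD.
  by rewrite le_eqVlt; apply/orP; left; apply/eqP; ring.
have := @bounded_linear_continuous _ _ _ g; apply.
apply/linear_boundedP; near=> r => v.
apply: (le_trans (gb v)); rewrite ler_wpM2r//.
Unshelve. all: by end_near. Qed.

Lemma mdot_near_gt0 w u : 0 < dot w u -> \forall v \near 0, 0 < dot (w + v) u.
Proof.
move=> wu; apply: (nbhs0P (fun v => 0 < dot v u) w).1.
exact: (cvgr_gt (dot w u) (@mdot_continuous u w) _ wu).
Qed.

(** A timelike vector is never orthogonal to [f3], so the sign of [dot v f3] is constant on a
    component; conversely, the timelike vectors of one sign form a convex set. *)
Lemma Future_frame : exists f1 f2 f3 : V, lorentz_frame M f1 f2 f3 /\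
  Future M = [set v | dot v v < 0 /\ dot v f3 < 0].
Proof.
have [f1 [f2 [f [f11 [f12 _]]]]] := mdot_signature M.
have fO : lorentz_frame M f1 f2 f by [].
have [v0 v0t ->] := Future_component M.
have [f3 [f3O v03]] : exists f3, lorentz_frame M f1 f2 f3 /\ dot v0 f3 < 0.
  have v0n : dot v0 f != 0.
    apply/eqP => v00; move: v0t; rewrite (mdot_coord _ _ fO) v00 mul0r subr0.
    by rewrite ltNge addr_ge0// -expr2 sqr_ge0.
  move: v0n; rewrite neq_lt => /orP[v0f|v0f]; first by exists f.
  exists (- f); split; last by rewrite mdotNr oppr_lt0.
  by move: fO => [[h11 h22 h33] [h12 h13 h23]]; split; split;
    rewrite ?mdotE ?opprK ?h11 ?h22 ?h33 ?h12 ?h13 ?h23 ?oppr0.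
exists f1, f2, f3; split=> //; apply/seteqP; split.
  set C := connected_component _ _ => v Cv.
  have CT : C `<=` [set v | dot v v < 0] by exact: connected_component_sub.
  split; first exact: CT.
  rewrite ltNge; apply/negP => v3.
  have Cc : connected C by exact: component_connected.
  have Cfc : {within C, continuous (fun v => dot v f3 : R)}.
    by apply: continuous_subspaceT; exact: mdot_continuous.
  have /connected_intervalP itv := connected_continuous_connected Cc Cfc.
  have [z Cz z0] : [set dot x f3 | x in C] 0.
    have C0 : [set dot x f3 | x in C] (dot v0 f3).
      by exists v0 => //; exact: connected_component_refl.
    have Cv3 : [set dot x f3 | x in C] (dot v f3) by exists v.
    by apply: (itv _ _ C0 Cv3); rewrite v3 ltW.
  have := CT _ Cz; rewrite /= (mdot_coord _ _ f3O) z0 mul0r subr0.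
  by rewrite ltNge addr_ge0// -expr2 sqr_ge0.
move=> v /= [vt v3].
pose g (t : R) := v0 + t *: (v - v0).
have gc : continuous g.
  move=> t; apply: cvgD; first exact: cvg_cst.
  by have := @cvgZr_tmp _ _ _ (nbhs t) _ id t (v - v0); apply; exact: cvg_id.
have gcc : connected (g @` `[0, 1]).
  apply: connected_continuous_connected; first exact: segment_connected.
  exact: continuous_subspaceT.
have /(_ v) : g @` `[0, 1] `<=` connected_component [set v | dot v v < 0] v0.
  apply: connected_component_max => //.
    by exists 0; rewrite /g /= ?scale0r ?addr0// in_itv /= lexx ler01.
  move=> _ [t /= + <-]; rewrite in_itv /= => /andP[t0 t1].
  rewrite /g (_ : _ + _ = (1 - t) *: v0 + t *: v); last first.
    by rewrite scalerBl scale1r scalerBr addrAC addrA.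
  have vv0 : dot v v0 < 0.
    rewrite (mdot_coord _ _ f3O) reverse_Cauchy_Schwarz -?(mdot_coord _ _ f3O)//.
    - by rewrite nmulr_rgt0.
    - exact: ltW.
    - by rewrite lt_eqF.
  rewrite /= !mdotE (mdotC _ v0 v).
  have [->|tN] := eqVneq t 0; first by rewrite subr0 !mul0r !mul1r !addr0.
  have tp : 0 < t by rewrite lt_neqAle eq_sym tN.
  have h1 : (1 - t) * (1 - t) * dot v0 v0 <= 0.
    by rewrite mulr_ge0_le0 ?mulr_ge0 ?subr_ge0// ltW.
  have h2 : t * (1 - t) * dot v v0 <= 0.
    by rewrite mulr_ge0_le0 ?mulr_ge0 ?subr_ge0// ltW.
  have h3 : t * t * dot v v < 0 by rewrite pmulr_rlt0// mulr_gt0.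
  lra.
apply; exists 1; first by rewrite /= in_itv /= lexx ler01.
by rewrite /g scale1r addrC subrK.
Qed.
End LorentzTopology.

(** * Null frames and crooked halfspaces *)

Section CrookedHalfspaces.
Variables (R : realType) (V : normedModType R) (M : minkowskiVect V).
Local Notation dot := (mdot M).
Local Notation vol := (mvol M).
Implicit Types u v w : V.

Lemma Future_mdot_lt0 u v : Future M u -> Future M v -> dot u v < 0.
Proof.
have [f1 [f2 [f3 [fO ->]]]] := Future_frame M => -[uu u3] [vv v3].
rewrite (mdot_coord _ _ fO) reverse_Cauchy_Schwarz -?(mdot_coord _ _ fO)//.
- by rewrite nmulr_rgt0.
- exact: ltW.
- by rewrite lt_eqF.
Qed.

(** The product of [v] with any vector of [Future] has the same sign, so [f3] can replace [x]. When
    that sign is negative, [v] is the limit of the vectors [v + k *: f3] of [Future] as [k]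
    decreases to 0. *)
Lemma future_pointing_null x v : Future M x -> v != 0 -> dot v v = 0 ->
  future_pointing M v <-> dot v x < 0.
Proof.
move=> + v0 vv; rewrite /future_pointing /=.
have [f1 [f2 [f3 [fO ->]]]] := Future_frame M => -[xx x3].
have v3N : dot v f3 != 0.
  apply/eqP => v30; move/eqP: v0; apply.
  move: (vv); rewrite (mdot_coord _ _ fO) v30 mul0r subr0 => /eqP.
  rewrite -!expr2 paddr_eq0 ?sqr_ge0// !sqrf_eq0 => /andP[/eqP v1 /eqP v2].
  exact: (lorentz_frame_eq0 fO).
have -> : (dot v x < 0) = (dot v f3 < 0).
  rewrite (mdot_coord _ _ fO) reverse_Cauchy_Schwarz -?(mdot_coord _ _ fO)//.
  - by rewrite nmulr_lgt0.
  - by rewrite vv.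
split=> [[_ _ cl]|v3].
  rewrite lt_neqAle v3N leNgt; apply/negP => v3.
  have [|z [/= [_ z3]]] := cl [set z | 0 < dot z f3].
    exact: (cvgr_gt (dot v f3) (@mdot_continuous _ _ M f3 v) _ v3).
  by rewrite ltNge ltW.
split=> //; first by rewrite vv.
move=> B vB.
have /nbhs_normP[e /= e0 kB] : \forall k \near (0 : R), B (v + k *: f3).
  exact: (near0Z f3 ((nbhs0P B v).1 vB)).
have k0 : 0 < e / 2 by rewrite divr_gt0.
exists (v + (e / 2) *: f3); split; last first.
  by apply: kB; rewrite /= sub0r normrN gtr0_norm//; lra.
set k := e / 2 in k0 *.
have [[_ _ h33] _] := fO.
split; rewrite !mdotE ?(mdotC _ f3 v) h33 ?vv; nra.
Qed.

Lemma mvolP1 v w a u1 u2 : vol (a *: u1 + u2) v w = a * vol u1 v w + vol u2 v w.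
Proof. exact: mvol_linear1. Qed.

Lemma mvolP2 u w a v1 v2 : vol u (a *: v1 + v2) w = a * vol u v1 w + vol u v2 w.
Proof. exact: mvol_linear2. Qed.

Lemma mvolP3 u v a w1 w2 : vol u v (a *: w1 + w2) = a * vol u v w1 + vol u v w2.
Proof. exact: mvol_linear3. Qed.

Lemma mvol_swap12 u v w : vol v u w = - vol u v w.
Proof.
by have := mvol_alt12 M (1 *: u + v) w; rewrite mvolP1 !mvolP2 !mvol_alt12; lra.
Qed.

Lemma mvol_swap23 u v w : vol u w v = - vol u v w.
Proof.
by have := mvol_alt23 M u (1 *: v + w); rewrite mvolP2 !mvolP3 !mvol_alt23; lra.
Qed.

Lemma mvol03 u v : vol u v 0 = 0.
Proof. by have := mvolP3 u v 1 0 0; rewrite scaler0 addr0; lra. Qed.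

Lemma mvol_comb2 s e t (a b c d : R) :
  vol s (a *: t + b *: e) (c *: t + d *: e) = (b * c - a * d) * vol s e t.
Proof.
have v02 w : vol s 0 w = 0 by rewrite mvol_swap23 mvol03 oppr0.
rewrite -[b *: e]addr0 -[d *: e]addr0 !(mvolP2, mvolP3) !mvol_alt23 !v02 !mvol03.
by rewrite (mvol_swap23 s e t); ring.
Qed.

Lemma mvol_frame_neq0 e1 e2 e3 : lorentz_frame M e1 e2 e3 -> vol e1 e2 e3 != 0.
Proof.
move=> fO; apply/eqP => v0; have [u [v [w]]] := mvol_neq0 M.
rewrite (lorentz_frame_decomp u fO) (lorentz_frame_decomp v fO)
  (lorentz_frame_decomp w fO).
have v02 x z : vol x 0 z = 0 by rewrite mvol_swap23 mvol03 oppr0.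
have v01 y z : vol 0 y z = 0 by rewrite mvol_swap12 v02 oppr0.
have alt13 x y : vol x y x = 0 by rewrite mvol_swap23 mvol_alt12 oppr0.
have v1 : vol e2 e1 e3 = 0 by rewrite mvol_swap12 v0 oppr0.
have v2 : vol e1 e3 e2 = 0 by rewrite mvol_swap23 v0 oppr0.
have v3 : vol e2 e3 e1 = 0 by rewrite mvol_swap23 v1 oppr0.
have v4 : vol e3 e1 e2 = 0 by rewrite mvol_swap12 v2 oppr0.
have v5 : vol e3 e2 e1 = 0 by rewrite mvol_swap23 v4 oppr0.
(* The added zeros give every sum the shape [a *: u1 + u2] of the linearity lemmas. *)
rewrite -!addrA -[_ *: e3]addr0 -[(- dot v e3) *: e3]addr0 -[(- dot w e3) *: e3]addr0.
by rewrite !(mvolP1, mvolP2, mvolP3, mvol_alt12, mvol_alt23, alt13, v01, v02,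
  mvol03, v0, v1, v2, v3, v4, v5) !(mulr0, addr0) eqxx.
Qed.

(** In this order, positive orientation puts s^- on the ray of [t + e] and s^+ on that of
    [t - e]. *)
Definition adapted_frame s e t : Prop :=
  [/\ lorentz_frame M s e t, Future M t & 0 < vol s e t].

(** The null lines orthogonal to [s] are spanned by [t + e] and [t - e]. The orientation tells them
    apart, and [dot (t + e) (t - e) = -2] ties the two factors together. *)
Lemma null_frame_adapted s e t sm sp : adapted_frame s e t ->
  null_frame M s sm sp <->
  exists2 c : R, 0 < c & sm = c *: (t + e) /\ sp = (2 * c)^-1 *: (t - e).
Proof.
move=> [fO Ft vp]; have [[hs he ht] [hse hst het]] := fO.
have dotF u v : dot u v = dot u s * dot v s + dot u e * dot v e - dot u t * dot v t.
  exact: mdot_coord.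
split=> [|[c c0 [-> ->]]].
  rewrite /null_frame /= => -[[sms sps] [smm spp] [fm fp] mp ori].
  have sm0 : sm != 0 by have [] := fm.
  have sp0 : sp != 0 by have [] := fp.
  have smt := (future_pointing_null Ft sm0 smm).1 fm.
  have spt := (future_pointing_null Ft sp0 spp).1 fp.
  have smE : sm = (- dot sm t) *: t + dot sm e *: e.
    by rewrite {1}(lorentz_frame_decomp sm fO) sms scale0r add0r addrC.
  have spE : sp = (- dot sp t) *: t + dot sp e *: e.
    by rewrite {1}(lorentz_frame_decomp sp fO) sps scale0r add0r addrC.
  rewrite smE spE mvol_comb2 pmulr_lgt0// in ori.
  move: smm spp mp; rewrite (dotF sm sm) (dotF sp sp) (dotF sm sp) sms sps !mul0r !add0r.
  set a := dot sm t in smt smE ori *; set b := dot sm e in smE ori *.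
  set c := dot sp t in spt spE ori *; set d := dot sp e in spE ori *.
  move=> h1 h2 h3.
  (* Nullity leaves [b = a] or [b = - a], and [d = c] or [d = - c]. Equal signs would put both
     vectors on one null line, against the normalization; [b = a] with [d = - c] has the wrong
     orientation. *)
  have hb : b = - a.
    have /eqP : (b - a) * (b + a) = 0 by lra.
    rewrite mulf_eq0 subr_eq0 addr_eq0 => /orP[/eqP ba|/eqP//].
    have /eqP : (d - c) * (d + c) = 0 by lra.
    rewrite mulf_eq0 subr_eq0 addr_eq0 => /orP[/eqP dc|/eqP dc].
      by exfalso; move: h3; rewrite ba dc; lra.
    by exfalso; move: ori; rewrite ba dc; nra.
  have hd : d = c.
    have /eqP : (d - c) * (d + c) = 0 by lra.
    rewrite mulf_eq0 subr_eq0 addr_eq0 => /orP[/eqP//|/eqP dc].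
    by exfalso; move: h3; rewrite hb dc; lra.
  exists (- a); first by rewrite oppr_gt0.
  split; first by rewrite smE hb scalerDr.
  have ac : 2 * a * c = 1 by move: h3; rewrite hb hd; lra.
  have -> : (2 * - a)^-1 = - c.
    have a0 : 2 * - a != 0 by rewrite mulf_neq0 ?oppr_eq0 ?pnatr_eq0// lt_eqF.
    by apply: (mulfI a0); rewrite mulfV//; lra.
  by rewrite spE hd scalerBr !scaleNr opprK.
have c20 : 0 < (2 * c)^-1 by rewrite invr_gt0 mulr_gt0.
have tp : dot (t + e) (t + e) = 0 by rewrite !mdotE (mdotC _ t e) he ht het; ring.
have tm : dot (t - e) (t - e) = 0 by rewrite !mdotE (mdotC _ t e) he ht het; ring.
have fp (k : R) w : 0 < k -> dot w w = 0 -> dot w t = -1 -> future_pointing M (k *: w).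
  move=> k0 ww wt; apply/(future_pointing_null Ft).
  - apply/negP => /eqP kw; have : dot (k *: w) t = 0 by rewrite kw mdotC mdot0r.
    by rewrite mdotZl wt; lra.
  - by rewrite mdotZl mdotZr ww !mulr0.
  - by rewrite mdotZl wt; lra.
rewrite /null_frame /=; split.
- by rewrite !mdotE (mdotC _ t s) (mdotC _ e s) hst hse oppr0 addr0 !mulr0.
- by rewrite !mdotZl !mdotZr tp tm !mulr0.
- split; apply: fp => //; rewrite !mdotE ht het; ring.
- rewrite !mdotZl !mdotZr !mdotE ht he (mdotC _ t e) het.
  have : c * (2 * c)^-1 = 2^-1 by rewrite invfM mulrCA mulfV ?mulr1// gt_eqF.
  by move=> h; rewrite mulrA h; lra.
- rewrite !scalerDr scalerN -scaleNr mvol_comb2 mulr_gt0//.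
  by rewrite -mulrBr opprK mulr_gt0// addr_gt0.
Qed.

(* The crooked halfspace in the coordinates X = w.s, U = w.t, y = w.e of
   w = q - p, where (s, e, t) is an adapted frame. *)
Definition crooked_model (X U y : R) : Prop :=
  [\/ U < y /\ 0 < X, [/\ U < y, - U < y & X = 0] | - U < y /\ X < 0].

Lemma crooked_halfspace_adapted (E : affineSpace V) (p q : E) s e t :
  adapted_frame s e t ->
  crooked_halfspace M p s q <->
  crooked_model (dot (difference q p) s) (dot (difference q p) t)
    (dot (difference q p) e).
Proof.
move=> ad; rewrite /crooked_halfspace /=; set w := difference q p.
have H c : 0 < c -> (dot w ((2 * c)^-1 *: (t - e)) < 0) = (dot w t < dot w e)
    /\ (0 < dot w (c *: (t + e))) = (- dot w t < dot w e).
  move=> c0; have c20 : 0 < (2 * c)^-1 by rewrite invr_gt0 mulr_gt0.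
  by rewrite !mdotZr pmulr_rlt0// pmulr_rgt0// !mdotE subr_lt0 -ltrBlDl sub0r.
split=> [[sm [sp [/(null_frame_adapted _ _ ad)[c c0 [-> ->]]]]]|].
  by have [-> ->] := H c c0.
move=> h; exists (1 *: (t + e)), ((2 * 1)^-1 *: (t - e)); split.
  by apply/(null_frame_adapted _ _ ad); exists 1.
by have [-> ->] := H 1 ltr01.
Qed.
End CrookedHalfspaces.

(** * Translational semigroups and crooked planes *)

(** Each violated condition is refuted by a test point. If [a] is nonzero, a point at [X = - a / 2]
    crosses to the other side of [X = 0], with [U] too large in absolute value to be allowed there;
    otherwise the point lands exactly on a wing, which the strict inequalities exclude. *)
Lemma crooked_model_semigroup (R : realType) (a b c : R) :
  (forall X U y : R, crooked_model X U y -> crooked_model (X + a) (U + b) (y + c)) <->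
  [/\ a = 0, b <= c & - b <= c].
Proof.
split=> [h|[-> bc nbc] X U y]; last first.
  rewrite /crooked_model addr0 => -[[? ?]|[? ? ?]|[? ?]];
    [apply: Or31|apply: Or32|apply: Or33]; split=> //; lra.
have a0 : a = 0.
  apply/eqP; rewrite eq_le; apply/andP; split; rewrite leNgt; apply/negP => a0.
    have := ler_norm (c - b); have := normr_ge0 (c - b) => n0 n1.
    have /h : crooked_model (- a / 2) (`|c - b| + 1) 0.
      by apply: Or33; split; lra.
    by case=> [[? ?]|[? ? ?]|[? ?]]; lra.
  have := ler_norm (c + b); have := normr_ge0 (c + b) => n0 n1.
  have /h : crooked_model (- a / 2) (- (`|c + b| + 1)) 0.
    by apply: Or31; split; lra.
  by case=> [[? ?]|[? ? ?]|[? ?]]; lra.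
split=> //; rewrite leNgt; apply/negP => bc.
  have /h : crooked_model 1 0 (b - c) by apply: Or31; split; lra.
  by rewrite a0; case=> [[? ?]|[? ? ?]|[? ?]]; lra.
have /h : crooked_model (-1) 0 (- b - c) by apply: Or33; split; lra.
by rewrite a0; case=> [[? ?]|[? ? ?]|[? ?]]; lra.
Qed.

Lemma difference_translate (V : zmodType) (E : affineSpace V) (p q : E) v :
  difference (translate q v) p = difference q p + v.
Proof. by rewrite -{1}(differenceK p q) -translateD translateK. Qed.

(** The points [v - k *: w] stay in the span of [A], so for small [k] relative interiority keeps
    them in [A]. *)
Lemma rel_interior_subr (R : realType) (V : normedModType R) (A : set V) v w :
  rel_interior A v -> A w -> exists2 k : R, 0 < k & A (v - k *: w).
Proof.
move=> [Av /(nbhs0P _ v).1 vA] Aw.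
have /nbhs_normP[e /= e0 kA] := near0Z (- w) vA.
have k0 : 0 < e / 2 by rewrite divr_gt0.
exists (e / 2) => //; rewrite -scalerN.
apply: kA; first by rewrite /= sub0r normrN gtr0_norm//; lra.
exists 2, (fun i => if i == ord0 then 1 else - (e / 2)),
  (fun i => if i == ord0 then v else w); split; first by move=> i; case: ifP.
by rewrite !big_ord_recl big_ord0 /= scale1r addr0 scalerN scaleNr.
Qed.

Section CrookedPlanes.
Variables (R : realType) (V : normedModType R) (M : minkowskiVect V).
Variables (E : affineSpace V) (p : E) (s e t : V).
Hypothesis ad : adapted_frame M s e t.
Local Notation dot := (mdot M).

Let dotE2 := (mdotE, mdotC M e s, mdotC M t s, mdotC M t e).

Lemma translational_semigroup_adapted v :
  translational_semigroup (crooked_halfspace M p s) v <->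
  [/\ dot v s = 0, dot v t <= dot v e & - dot v t <= dot v e].
Proof.
have [[[hs he ht] [hse hst het]] _ _] := ad.
rewrite -crooked_model_semigroup; split=> [h X U y m|h q].
  have mE : crooked_halfspace M p s (translate p (X *: s + y *: e - U *: t)).
    apply/(crooked_halfspace_adapted _ _ ad); rewrite translateK.
    rewrite !dotE2 hs he ht hse hst het.
    by rewrite !mulr0 !mulr1 !oppr0 !addr0 !add0r mulrN1 opprK.
  move/h: mE => /(crooked_halfspace_adapted _ _ ad).
  rewrite difference_translate translateK !dotE2 hs he ht hse hst het.
  by rewrite !mulr0 !mulr1 !oppr0 !addr0 !add0r mulrN1 opprK.
move=> /(crooked_halfspace_adapted _ _ ad)/h m.
by apply/(crooked_halfspace_adapted _ _ ad); rewrite difference_translate !mdotE.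
Qed.

(** The edges of the cone are spanned by [e + t] and [e - t]. Subtracting a small multiple of either
    one makes one of the two weak inequalities strict. *)
Lemma rel_interior_semigroup v :
  rel_interior (translational_semigroup (crooked_halfspace M p s)) v ->
  dot v s = 0 /\ `|dot v t| < dot v e.
Proof.
move=> iv; have [[[hs he ht] [hse hst het]] _ _] := ad.
have [/translational_semigroup_adapted[vs _ _] _] := iv.
have [|k k0 /translational_semigroup_adapted] := @rel_interior_subr _ _ _ v (e + t) iv.
  apply/translational_semigroup_adapted.
  by rewrite !dotE2 he ht hse hst het; split; lra.
have [|l l0 /translational_semigroup_adapted] := @rel_interior_subr _ _ _ v (e - t) iv.
  apply/translational_semigroup_adapted.
  by rewrite !dotE2 he ht hse hst het; split; lra.
rewrite !dotE2 he ht hse hst het => -[_ _ h1] [_ h2 _].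
by split=> //; rewrite ltr_norml; apply/andP; split; lra.
Qed.

(** On the wings [g] is 1 for X > 0 and -1 for X < 0; on the stem X = 0 it is the slope y / U, or 0
    when U = 0. Any other point has a neighborhood inside the halfspace or disjoint from it. *)
Lemma crooked_plane_adapted q : crooked_plane M p s q ->
  let w := difference q p in
  exists g : R, [/\ `|g| <= 1, g * dot w s = `|dot w s| & dot w e = g * dot w t].
Proof.
move=> [cl ni] w.
pose H := [set v | crooked_halfspace M p s (translate q v)].
have HE v : H v <-> crooked_model (dot (w + v) s) (dot (w + v) t) (dot (w + v) e).
  by rewrite /H /= (crooked_halfspace_adapted _ _ ad) difference_translate.
(* Two strict linear inequalities persist near [q]. By [out], some point of the halfspace satisfies
   them, [q] being in the closure; by [inn], they cannot imply membership, [q] not being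
   interior. *)
have out u1 u2 : 0 < dot w u1 -> 0 < dot w u2 ->
    exists v, [/\ H v, 0 < dot (w + v) u1 & 0 < dot (w + v) u2].
  move=> h1 h2; have [|v [Hv [v1 v2]]] := cl
      [set v | 0 < dot (w + v) u1 /\ 0 < dot (w + v) u2].
    by apply: filterI; exact: mdot_near_gt0.
  by exists v.
have inn u1 u2 : 0 < dot w u1 -> 0 < dot w u2 ->
    (forall v, 0 < dot (w + v) u1 -> 0 < dot (w + v) u2 -> H v) -> False.
  move=> h1 h2 h; apply: ni.
  have : \forall v \near (0 : V), 0 < dot (w + v) u1 /\ 0 < dot (w + v) u2.
    by apply: filterI; exact: mdot_near_gt0.
  by apply: filterS => v [v1 v2]; exact: h.
have [Xp|Xn|X0] := ltrgtP 0 (dot w s).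
- exists 1; rewrite normr1 !mul1r gtr0_norm//; split=> //.
  apply/eqP; rewrite eq_le; apply/andP; split; rewrite leNgt; apply/negP => h.
    apply: (inn s (e - t)) => //; first by rewrite !mdotE subr_gt0.
    move=> v v1 v2; apply/HE; apply: Or31; split=> //.
    by move: v2; rewrite [dot _ (e - t)]mdotDr mdotNr subr_gt0.
  have [||v [/HE]] := out s (t - e) => //; first by rewrite !mdotE subr_gt0.
  rewrite [dot _ (t - e)]mdotDr mdotNr subr_gt0.
  by move=> [[? ?]|[? ? ?]|[? ?]] ? ?; lra.
- exists (-1); rewrite normrN1 !mulN1r ltr0_norm//; split=> //.
  apply/eqP; rewrite eq_le; apply/andP; split; rewrite leNgt; apply/negP => h.
    apply: (inn (- s) (e + t)); first by rewrite mdotNr oppr_gt0.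
      by rewrite !mdotE; lra.
    move=> v; rewrite mdotNr oppr_gt0 mdotDr => v1 v2; apply/HE; apply: Or33.
    by split=> //; lra.
  have [||v [/HE]] := out (- s) (- (e + t)).
  - by rewrite mdotNr oppr_gt0.
  - by rewrite !mdotE; lra.
  rewrite !mdotNr mdotDr.
  by move=> [[? ?]|[? ? ?]|[? ?]] ? ?; lra.
- have y1 : dot w e <= `|dot w t|.
    rewrite leNgt lter_norml; apply/negP => /andP[h1 h2].
    apply: (inn (e - t) (e + t)); [by rewrite !mdotE; lra|by rewrite !mdotE; lra|].
    move=> v; rewrite !(mdotDr, mdotNr) => v1 v2; apply/HE.
    have [?|?|?] := ltrgtP 0 (dot (w + v) s);
      [apply: Or31|apply: Or33|apply: Or32]; split; lra.
  have y2 : - dot w e <= `|dot w t|.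
    rewrite leNgt lter_norml; apply/negP => /andP[h1 h2].
    have [||v [/HE]] := out (t - e) (- (e + t)); [by rewrite !mdotE; lra|
      by rewrite !mdotE; lra|].
    rewrite mdotNr !mdotDr mdotNr.
    by move=> [[? ?]|[? ? ?]|[? ?]] ? ?; lra.
  rewrite -X0 normr0; have yU : `|dot w e| <= `|dot w t|.
    by rewrite ler_norml; apply/andP; split=> //; lra.
  have [U0|U0] := eqVneq (dot w t) 0.
    exists 0; rewrite normr0 !mul0r; split=> //.
    by move: yU; rewrite U0 normr0 normr_le0 => /eqP.
  exists (dot w e / dot w t); split; last by rewrite divfK.
    by rewrite normf_div ler_pdivrMr ?normr_gt0// mul1r.
  by rewrite mulr0.
Qed.
End CrookedPlanes.

(** * Paths and hyperbolic inequalities *)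

Lemma difference_chain (V : zmodType) (E : affineSpace V) (p q r : E) :
  difference p r = difference q r + difference p q.
Proof. by rewrite -difference_translate differenceK. Qed.

(** This carries a linear inequality from the velocity to the displacement without integration: the
    difference quotients of [h] are positive near each [t], so [locally_increasing] applies. *)
Lemma path_mdot_gt0 (R : realType) (V : normedModType R) (M : minkowskiVect V)
    (E : affineSpace V) (a b : R) (p : R -> E) (dp : R -> V) (t1 t2 : R) y :
  regular_path a b p dp -> t1 \in `[a, b] -> t2 \in `[a, b] -> t1 < t2 ->
  (forall t, t \in `[t1, t2] -> 0 < mdot M (dp t) y) ->
  0 < mdot M (difference (p t2) (p t1)) y.
Proof.
move=> [pd _ _] ta1 ta2 t12 dpy.
pose h u := mdot M (difference (p u) (p t1)) y.
have h1 : h t1 = 0.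
  rewrite /h; suff -> : difference (p t1) (p t1) = 0 by rewrite mdotC mdot0r.
  have /eqP := difference_chain (p t1) (p t1) (p t1).
  by rewrite addrC -subr_eq subrr => /eqP.
suff : h t1 < h t2 by rewrite h1.
apply: (locally_increasing t12) => t t12t.
have sub u : u \in `[t1, t2] -> u \in `[a, b].
  move: ta1 ta2; rewrite !in_itv /= => /andP[? ?] /andP[? ?] /andP[? ?].
  by apply/andP; split; lra.
have := pd t (sub _ t12t).
move=> /(continuous_cvg _ (@mdot_continuous _ _ M y (dp t))) c.
have /nbhs_normP[e /= e0 he] : \forall u \near t, u != t -> `[a, b]%classic u ->
    0 < mdot M ((u - t)^-1 *: difference (p u) (p t)) y.
  exact: (cvgr_gt _ c _ (dpy _ t12t)).
exists e => // u ut12 ut ue.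
have := he u; rewrite /= distrC => /(_ ue ut (sub _ ut12)).
rewrite mdotZl (_ : mdot _ _ _ = h u - h t); last first.
  by rewrite /h (difference_chain (p u) (p t) (p t1)) mdotDl addrC addKr.
rewrite -subr_eq0 in ut => q.
have : 0 < (u - t) ^+ 2 * ((u - t)^-1 * (h u - h t)).
  by rewrite mulr_gt0// exprn_even_gt0.
by rewrite expr2 mulrA mulfK// mulrC.
Qed.

(* P and Q are the coordinates of a unit-spacelike vector along the two null
   lines of the plane of l, and k > 0 parametrizes the points of l. *)
Lemma half_line_inclusion (R : realFieldType) (P Q P' Q' : R) :
  P * Q = 1 -> P' * Q' = 1 ->
  (forall k, 0 < k -> Q' < k ^+ 2 * P' -> Q < k ^+ 2 * P) ->
  0 < P * P' /\ P' <= P.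
Proof.
move=> PQ PQ' h.
have P0 : P != 0 by apply/eqP => P0; move: PQ; rewrite P0 mul0r; lra.
have P0' : P' != 0 by apply/eqP => P0'; move: PQ'; rewrite P0' mul0r; lra.
have k0 (k : R) : 0 < k -> (k * k * P <= Q) -> k * k * P' <= Q'.
  by move=> kp; rewrite !leNgt -!expr2; apply: contra; exact: h.
(* Hence [Q < k ^+ 2 * P] means [Q < k] when [0 < P] and [k < - Q] when [P < 0]. For equal signs of
   [P] and [P'] the end of the larger half-line is tested; for opposite signs, a small or a large
   [k] separates the half-lines. *)
have QQP : Q * Q * P = Q by rewrite -mulrA (mulrC Q P) PQ mulr1.
have QQP' : Q' * Q' * P' = Q' by rewrite -mulrA (mulrC Q' P') PQ' mulr1.
have [P'n|P'p] : P' < 0 \/ 0 < P' by apply/orP; rewrite -neq_lt.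
  have Q'n : Q' < 0 by nra.
  have [Pn|Pp] : P < 0 \/ 0 < P by apply/orP; rewrite -neq_lt.
    have Qn : Q < 0 by nra.
    split; first nra.
    rewrite leNgt; apply/negP => PP'.
    have QQ : Q' < Q by nra.
    have : - Q * - Q * P' <= Q' by apply: k0; [lra|rewrite mulrNN QQP].
    rewrite mulrNN -QQP' ler_nM2r// leNgt => /negP; apply; nra.
  have Qp : 0 < Q by nra.
  pose k := Num.min Q (- Q' / 2).
  have kp : 0 < k by rewrite lt_min Qp; lra.
  have kQ : k <= Q by rewrite ge_min lexx.
  have kQ' : k <= - Q' / 2 by rewrite ge_min lexx orbT.
  have : k * k * P' <= Q'.
    by apply: k0 => //; rewrite -[leRHS]QQP ler_pM2r// ler_pM// ltW.
  rewrite -[leRHS]QQP' ler_nM2r// -mulrNN => kk.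
  have : k * k < - Q' * - Q' by rewrite ltr_pM// ?ltW//; lra.
  by rewrite mulrNN; lra.
have Q'p : 0 < Q' by nra.
have [Pn|Pp] : P < 0 \/ 0 < P by apply/orP; rewrite -neq_lt.
  have Qn : Q < 0 by nra.
  have kp : 0 < Q' - Q by lra.
  have : (Q' - Q) * (Q' - Q) * P' <= Q'.
    apply: k0 => //; rewrite -[leRHS]QQP ler_nM2r// -mulrNN.
    by rewrite ler_pM; lra.
  rewrite -[leRHS]QQP' ler_pM2r//; nra.
have Qp : 0 < Q by nra.
split; first nra.
rewrite leNgt; apply/negP => PP'.
have QQ : Q' < Q by nra.
have : Q * Q * P' <= Q' by apply: k0; rewrite ?QQP.
rewrite -[leRHS]QQP' ler_pM2r//; nra.
Qed.

(* The left-hand side is at most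
   [|ds| + |A ds + C dt| + (1 - A) (|X1| + |X2|)], and [1 <= A]. *)
Lemma crossing_bound (R : realFieldType) (A C X1 X2 U1 U2 ds dt g1 g2 : R) :
  0 < A -> A ^+ 2 - C ^+ 2 = 1 ->
  X2 = A * (X1 - ds) + C * (U1 - dt) -> U2 = C * (X1 - ds) + A * (U1 - dt) ->
  `|g1| <= 1 -> `|g2| <= 1 -> g1 * X1 = `|X1| -> g2 * X2 = `|X2| ->
  C * (g1 * U1 - g2 * U2) <= `|ds| + `|A * ds + C * dt|.
Proof.
move=> A0 AC hX hU g1n g2n s1 s2.
have A1 : 1 <= A by have := sqr_ge0 C; nra.
have e1 : C * U1 = X2 - A * X1 + (A * ds + C * dt) by rewrite hX; ring.
have e2 : C * U2 = A * X2 - (X1 - ds).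
  rewrite hU hX; apply/eqP; rewrite -subr_eq0; apply/eqP.
  have -> : C * (C * (X1 - ds) + A * (U1 - dt)) -
    (A * (A * (X1 - ds) + C * (U1 - dt)) - (X1 - ds))
    = (X1 - ds) * (1 - (A ^+ 2 - C ^+ 2)) by ring.
  by rewrite AC subrr mulr0.
have b (g x : R) : `|g| <= 1 -> g * x <= `|x|.
  move=> gn; apply: (le_trans (ler_norm _)); rewrite normrM.
  by rewrite ler_piMl.
have -> : C * (g1 * U1 - g2 * U2) = g1 * X2 + g2 * X1 - A * (g1 * X1 + g2 * X2)
    + g1 * (A * ds + C * dt) + g2 * (- ds).
  have -> : C * (g1 * U1 - g2 * U2) = g1 * (C * U1) - g2 * (C * U2) by ring.
  by rewrite e1 e2; ring.
rewrite s1 s2.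
have := b _ X2 g1n; have := b _ X1 g2n.
have := b _ (A * ds + C * dt) g1n; have := b _ (- ds) g2n; rewrite normrN.
have := normr_ge0 X1; have := normr_ge0 X2.
have : `|X1| + `|X2| <= A * (`|X1| + `|X2|).
  by rewrite ler_peMl// addr_ge0.
lra.
Qed.

(* With (A, C) = (cosh r, sinh r), (A2, C2) = (cosh r2, sinh r2) and
   0 <= r <= r2, the last conjunct is sinh r + sinh (r2 - r) <= sinh r2. *)
Lemma rapidity_superadditive (R : realFieldType) (A C A2 C2 : R) :
  A ^+ 2 - C ^+ 2 = 1 -> A2 ^+ 2 - C2 ^+ 2 = 1 -> 0 < A2 - C2 ->
  A2 - C2 <= A - C -> A - C <= 1 ->
  [/\ 0 <= C, C * A2 - A * C2 <= 0 & C - (C * A2 - A * C2) <= C2].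
Proof.
move=> h h2 p0 p2 p1.
pose P := A - C; pose Q := A + C; pose P2 := A2 - C2; pose Q2 := A2 + C2.
have PQ : P * Q = 1 by rewrite /P /Q -h; ring.
have PQ2 : P2 * Q2 = 1 by rewrite /P2 /Q2 -h2; ring.
rewrite -/P -/P2 in p0 p1 p2.
have P0 : 0 < P by lra.
have Q1 : 1 <= Q by nra.
have QQ : Q <= Q2 by nra.
have -> : C = (Q - P) / 2 by rewrite /Q /P; field.
have -> : C2 = (Q2 - P2) / 2 by rewrite /Q2 /P2; field.
have -> : A = (Q + P) / 2 by rewrite /Q /P; field.
have -> : A2 = (Q2 + P2) / 2 by rewrite /Q2 /P2; field.
have e : (Q - P) / 2 * ((Q2 + P2) / 2) - (Q + P) / 2 * ((Q2 - P2) / 2)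
  = (P2 * Q - P * Q2) / 2 by field.
rewrite e.
have h3 : P2 * Q <= 1 by rewrite -PQ ler_wpM2r//; lra.
have h4 : 1 <= P * Q2 by rewrite -PQ ler_wpM2l// ltW.
split; [lra|lra|].
have : 0 <= (1 - P) * ((Q2 - 1) * (1 - P2 * Q)).
  by rewrite !mulr_ge0//; lra.
have -> : (1 - P) * ((Q2 - 1) * (1 - P2 * Q)) =
    Q2 - P2 - Q + P - P * Q2 + P2 * Q
    + (1 - P2) * (P * Q - 1) - (1 - P) * Q * (P2 * Q2 - 1) by ring.
  rewrite PQ PQ2.
lra.
Qed.

(** * Leaves orthogonal to a geodesic *)

Section Leaves.
Variables (R : realType) (V : normedModType R) (M : minkowskiVect V).
Local Notation dot := (mdot M).
Local Notation vol := (mvol M).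

Lemma Future_of_mdot_lt0 x v : Future M x -> dot v v < 0 -> dot v x < 0 -> Future M v.
Proof.
have [f1 [f2 [f3 [fO ->]]]] := Future_frame M => -[xx x3] vv.
have v3N : dot v f3 != 0.
  apply/eqP => v30; move: vv; rewrite (mdot_coord _ _ fO) v30 mul0r subr0.
  by rewrite ltNge addr_ge0// -expr2 sqr_ge0.
rewrite (mdot_coord _ _ fO) reverse_Cauchy_Schwarz -?(mdot_coord _ _ fO)//.
  by rewrite nmulr_lgt0.
exact: ltW.
Qed.

(** Tangent vectors at the intersection [x] are the cross products of [s0] and [s] with [x]; their
    product is [dot s0 s], as [dot x x = -1]. The second frame vector does not depend on [s]. *)
Lemma orthogonal_geodesics_frame s0 s : spacelike M s0 -> unit_spacelike M s ->
  orthogonal_geodesics M (geodesic M s0) (geodesic M s) ->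
  exists x, lorentz_frame M s ((Num.sqrt (dot s0 s0))^-1 *: s0) x /\ Future M x.
Proof.
rewrite /spacelike /unit_spacelike /= => s00 ss.
move=> [x [[[xF xx] xs0] [_ xs] orth]]; exists x; split=> //.
have ss0 : dot s s0 = 0.
  have [c [c' [cs0 cx cs c'x cc']]] := cross_products M s0 s x.
  have := orth c c'; rewrite cc' xx !(mdotC _ _ x) xs0 mul0r sub0r mulrN1 opprK mdotC.
  apply; [exists s0|exists s]; split=> //.
  by rewrite /spacelike /= ss.
have sq : Num.sqrt (dot s0 s0) ^+ 2 = dot s0 s0 by rewrite sqr_sqrtr// ltW.
have sq0 : Num.sqrt (dot s0 s0) != 0 by rewrite gt_eqF// sqrtr_gt0.
split; split=> //.
- by rewrite mdotZl mdotZr -[X in _ * (_ * X)]sq expr2; field.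
- by rewrite mdotZr ss0 mulr0.
- by rewrite mdotC.
- by rewrite mdotZl mdotC xs0 mulr0.
Qed.

(** Both [(s, t)] and [(s1, t1)] are orthonormal bases of the plane orthogonal to [e]. Since [A] is
    positive and [t] is in [Future], they differ by a hyperbolic rotation, whose determinant 1
    preserves the orientation. *)
Lemma frame_boost s1 e t1 s t : adapted_frame M s1 e t1 ->
  lorentz_frame M s e t -> Future M t -> 0 < dot s s1 ->
  let A := dot s s1 in let C := - dot s t1 in
  [/\ s = A *: s1 + C *: t1, t = C *: s1 + A *: t1, A ^+ 2 - C ^+ 2 = 1 &
    adapted_frame M s e t].
Proof.
move=> [fO Ft1 vp] gO Ft A0 A C.
have [[hs he ht] [hse hst het]] := gO.
have [[h1 _ h3] [h12 h13 h23]] := fO.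
have sE : s = A *: s1 + C *: t1.
  by rewrite {1}(lorentz_frame_decomp s fO) hse scale0r addr0.
have tE0 : t = dot t s1 *: s1 + (- dot t t1) *: t1.
  by rewrite {1}(lorentz_frame_decomp t fO) (mdotC _ t e) het scale0r addr0.
have AC : A ^+ 2 - C ^+ 2 = 1.
  by have := hs; rewrite (mdot_coord s s fO) hse /A /C; lra.
set C' := dot t s1 in tE0; set A' := - dot t t1 in tE0.
have A'0 : 0 < A' by rewrite oppr_gt0 Future_mdot_lt0.
have AC' : A' ^+ 2 - C' ^+ 2 = 1.
  by have := ht; rewrite (mdot_coord t t fO) (mdotC _ t e) het /A' /C'; lra.
have mix : A * C' = C * A'.
  by have := hst; rewrite (mdot_coord s t fO) hse /A /C /A' /C'; lra.
have AA : A' ^+ 2 = A ^+ 2.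
  have : A ^+ 2 * (A' ^+ 2 - C' ^+ 2) = A' ^+ 2 * (A ^+ 2 - C ^+ 2).
    have -> : A ^+ 2 * (A' ^+ 2 - C' ^+ 2) = A ^+ 2 * A' ^+ 2 - (A * C') ^+ 2 by ring.
    by rewrite mix; ring.
  by rewrite AC AC' !mulr1.
have eA : A' = A.
  by apply/eqP; rewrite -(@eqrXn2 _ 2)// ?AA// ltW.
have eC : C' = C.
  have A0' : A != 0 by rewrite gt_eqF.
  by apply: (mulfI A0'); rewrite mix eA mulrC.
have tE : t = C *: s1 + A *: t1 by rewrite tE0 eA eC.
split=> //; split=> //.
have cyc x z : vol x e z = vol e z x by rewrite mvol_swap12 -mvol_swap23.
by rewrite cyc tE {1}sE mvol_comb2 -!expr2 AC mul1r -cyc.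
Qed.
End Leaves.

(** * Disjointness *)

Section Disjointness.
Variables (R : realType) (V : normedModType R) (M : minkowskiVect V).
Local Notation dot := (mdot M).

(** On the geodesic orthogonal to [e], the inclusion becomes one of half-lines. For
    [s = cosh r *: s1 + sinh r *: t1] the quantity compared is exp(- r). *)
Lemma half_plane_sub_le s1 e t1 s s' : lorentz_frame M s1 e t1 -> Future M t1 ->
  unit_spacelike M s -> dot s e = 0 -> unit_spacelike M s' -> dot s' e = 0 ->
  half_plane M s' `<=` half_plane M s ->
  0 < (dot s s1 + dot s t1) * (dot s' s1 + dot s' t1) /\
  dot s' s1 + dot s' t1 <= dot s s1 + dot s t1.
Proof.
rewrite /unit_spacelike /= => fO Ft1 su se su' se' sub.
have [[h1 _ h3] [_ h13 _]] := fO.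
apply: (half_line_inclusion (Q := dot s s1 - dot s t1) (Q' := dot s' s1 - dot s' t1)).
- by rewrite -su (mdot_coord s s fO) se; ring.
- by rewrite -su' (mdot_coord s' s' fO) se'; ring.
move=> k k0.
(* With [k = exp u] this is [sinh u *: s1 + cosh u *: t1], the unit-speed parametrization of that
   geodesic. *)
pose v := ((k - k^-1) / 2) *: s1 + ((k + k^-1) / 2) *: t1.
have kN : k != 0 by rewrite gt_eqF.
have vs u : dot v u = ((k ^+ 2 * (dot u s1 + dot u t1)) - (dot u s1 - dot u t1)) / (2 * k).
  by rewrite /v mdotDl !mdotZl !(mdotC _ _ u); field.
have pos u : (0 < dot v u) = (dot u s1 - dot u t1 < k ^+ 2 * (dot u s1 + dot u t1)).
  by rewrite vs pmulr_lgt0 ?invr_gt0 ?mulr_gt0// subr_gt0.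
rewrite -!pos => vs'; suff : half_plane M s v by case.
apply: sub; split=> //.
have vv : dot v v = -1.
  by rewrite /v !mdotDl !mdotDr !mdotZl !mdotZr (mdotC _ t1 s1) h1 h3 h13; field.
split=> //; apply: (Future_of_mdot_lt0 Ft1); first by rewrite vv ltrN10.
rewrite /v mdotDl !mdotZl h13 h3 mulr0 add0r mulrN1 oppr_lt0.
by rewrite divr_gt0// addr_gt0// invr_gt0.
Qed.

(** The [e]-coordinates of a common point relative to [p1] and [p2] differ by [dot d e], so
    [crossing_bound] contradicts the assumed inequality. *)
Lemma crooked_planes_disjoint (E : affineSpace V) (p1 p2 : E) s1 e t1 s2 t2 A C :
  adapted_frame M s1 e t1 -> adapted_frame M s2 e t2 ->
  s2 = A *: s1 + C *: t1 -> t2 = C *: s1 + A *: t1 -> A ^+ 2 - C ^+ 2 = 1 ->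
  0 < A ->
  let d := difference p2 p1 in
  `|dot d s1| + `|dot d s2| < C * dot d e ->
  crooked_plane M p1 s1 `&` crooked_plane M p2 s2 = set0.
Proof.
move=> ad1 ad2 s2E t2E AC A0 d hd; apply/seteqP; split=> // q [q1 q2].
have [g1 [g1n X1 Y1]] := crooked_plane_adapted ad1 q1.
have [g2 [g2n X2 Y2]] := crooked_plane_adapted ad2 q2.
set v := difference q p1 in X1 Y1; set w := difference q p2 in X2 Y2.
have vE : v = d + w by exact: difference_chain.
have wu u : dot w u = dot v u - dot d u by rewrite vE mdotDl; ring.
have hX : dot w s2 = A * (dot v s1 - dot d s1) + C * (dot v t1 - dot d t1).
  by rewrite s2E mdotDr !mdotZr !wu.
have hU : dot w t2 = C * (dot v s1 - dot d s1) + A * (dot v t1 - dot d t1).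
  by rewrite t2E mdotDr !mdotZr !wu.
have := crossing_bound A0 AC hX hU g1n g2n X1 X2.
rewrite -Y1 -Y2 wu opprB addrC subrK -!mdotZr -mdotDr -s2E.
by rewrite mdotZr leNgt hd.
Qed.

(** Here [v] is a combination of [e] and [t], so its products with [s1] and [s2] are those of [t]
    times [- dot v t], namely with the factors sinh r and sinh (r - r2). Their absolute values add
    up to at most [C2]. *)
Lemma velocity_bound s1 e t1 s t s2 A C A2 C2 v :
  lorentz_frame M s1 e t1 -> lorentz_frame M s e t ->
  s = A *: s1 + C *: t1 -> t = C *: s1 + A *: t1 -> s2 = A2 *: s1 + C2 *: t1 ->
  A ^+ 2 - C ^+ 2 = 1 -> A2 ^+ 2 - C2 ^+ 2 = 1 -> 0 < C2 -> 0 < A2 - C2 ->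
  A2 - C2 <= A - C -> A - C <= 1 ->
  dot v s = 0 -> `|dot v t| < dot v e ->
  `|dot v s1| + `|dot v s2| < C2 * dot v e.
Proof.
move=> fO gO sE tE s2E AC AC2 C20 p0 p2 p1 vs vt.
have [C0 D0 CD] := rapidity_superadditive AC AC2 p0 p2 p1.
have [[h1 _ h3] [h12 h13 h23]] := fO.
have vE := lorentz_frame_decomp v gO; rewrite vs scale0r add0r in vE.
have h1' : dot v s1 = - dot v t * C.
  rewrite {1}vE mdotDl !mdotZl (mdotC _ e s1) h12 mulr0 add0r tE.
  by rewrite mdotDl !mdotZl h1 (mdotC _ t1 s1) h13; ring.
have h2' : dot v s2 = - dot v t * (C * A2 - A * C2).
  rewrite {1}vE mdotDl !mdotZl s2E mdotDr !mdotZr (mdotC _ e s1) h12 h23.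
  rewrite tE !mdotE h1 h3 (mdotC _ t1 s1) h13; ring.
rewrite h1' h2' !normrM normrN (ger0_norm C0) (ler0_norm D0) -mulrDr.
apply: (@le_lt_trans _ _ (`|dot v t| * C2)); first by rewrite ler_wpM2l.
by rewrite mulrC ltr_pM2l.
Qed.

(** The absolute values are opened into four linear inequalities, the form that [path_mdot_gt0] can
    transfer. *)
Lemma normD_lt_signs (x y z : R) :
  `|x| + `|y| < z <-> forall e1 e2 : bool, 0 < z + (-1) ^+ e1 * x + (-1) ^+ e2 * y.
Proof.
split=> [h e1 e2|h].
  have := ler_norm ((-1) ^+ e1.+1 * x); have := ler_norm ((-1) ^+ e2.+1 * y).
  by rewrite !normrM !normrX !normrN1 !expr1n !mul1r !exprS !mulN1r !mulNr; lra.
have := (h true true, h true false, h false true, h false false).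
rewrite !expr0 !expr1 => -[[[? ?] ?] ?].
by case: (ler0P x) => ?; case: (ler0P y) => ?; lra.
Qed.
End Disjointness.

Unset Implicit Arguments.
Set Strict Implicit.
Set Printing Implicit Defensive.

Theorem proposition7p2 (R : realType) (V : normedModType R)
    (M : minkowskiVect V) (E : affineSpace V)
    (l : set V) (a b : R) (s : R -> V) (p : R -> E) (dp : R -> V)
    (hl : is_geodesic M l)
    (hs : parametrizes_leaves M l a b s)
    (hdir : points_along M a b s)
    (hp : regular_path a b p dp)
    (hdp : forall t, t \in `[a, b] ->
       rel_interior (translational_semigroup (crooked_halfspace M (p t) (s t)))
         (dp t)) :
  forall t1 t2 : R, t1 \in `[a, b] -> t2 \in `[a, b] -> t1 != t2 ->
    crooked_plane M (p t1) (s t1) `&` crooked_plane M (p t2) (s t2) = set0.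
Proof.
move=> t1 t2 + + /eqP; wlog t12 : t1 t2 / t1 < t2.
  move=> H i1 i2 /eqP; rewrite neq_lt => /orP[t12|t21].
    by apply: H => //; apply/eqP; rewrite lt_eqF.
  by rewrite setIC; apply: H => //; apply/eqP; rewrite lt_eqF.
move=> i1 i2 _; have [s0 s0p lE] := hl; have [su _ so sd] := hs.
have [e0 fr0] : exists e0, forall t, t \in `[a, b] ->
    exists x, lorentz_frame M (s t) e0 x /\ Future M x.
  exists ((Num.sqrt (mdot M s0 s0))^-1 *: s0) => t it.
  have := so t it; rewrite lE => /(orthogonal_geodesics_frame s0p).
  by apply; exact: su.
have [x1 [f0 Fx1]] := fr0 t1 i1.
(* The sign of the normal is fixed at [t1]; [frame_boost] carries the orientation to later
   parameters. *)
have [e [ad1 fr]] : exists e, adapted_frame M (s t1) e x1 /\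
    forall t, t \in `[a, b] -> exists x, lorentz_frame M (s t) e x /\ Future M x.
  have := mvol_frame_neq0 f0; rewrite neq_lt => /orP[v0|v0]; last by exists e0.
  have opp u x : lorentz_frame M u e0 x -> lorentz_frame M u (- e0) x.
    by move=> [[h11 h22 h33] [h12 h13 h23]]; split; split;
      rewrite ?mdotE ?opprK ?h11 ?h22 ?h33 ?h12 ?h13 ?h23 ?oppr0.
  exists (- e0); split; last first.
    by move=> t /fr0[x [/opp fx Fx]]; exists x.
  split=> //; first exact: opp.
  by rewrite mvol_swap23 -[- e0]addr0 -scaleN1r mvolP3 mvol03 mvol_swap23; lra.
have [fO _ _] := ad1; have [[h1 _ h3] [h12 h13 h23]] := fO.
(* Once positive, [P t] is exp(- r), with r the rapidity of [s t] relative to [s t1]. *)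
pose P t := mdot M (s t) (s t1) + mdot M (s t) x1.
have se t : t \in `[a, b] -> mdot M (s t) e = 0.
  by move=> /fr[x [[_ []]]].
have mono t t' : t \in `[a, b] -> t' \in `[a, b] -> t < t' ->
    0 < P t * P t' /\ P t' <= P t.
  move=> it it' tt'; apply: (half_plane_sub_le fO) => //.
  - exact: su.
  - exact: se.
  - exact: su.
  - exact: se.
  - exact: hdir.
have P1 : P t1 = 1 by rewrite /P h1 h13 addr0.
have PQ t : t \in `[a, b] -> P t * (mdot M (s t) (s t1) - mdot M (s t) x1) = 1.
  move=> it; have := su t it; rewrite /unit_spacelike /= (mdot_coord _ _ fO) (se t it).
  by rewrite /P => <-; ring.
have sub t : t \in `[t1, t2] -> t \in `[a, b].
  move: i1 i2; rewrite !in_itv /= => /andP[? ?] /andP[? ?] /andP[? ?].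
  by apply/andP; split; lra.
have Pt t : t \in `[t1, t2] -> [/\ 0 < P t, P t <= 1 & P t2 <= P t].
  move=> it; have it' := sub t it; move: it; rewrite in_itv /= => /andP[].
  rewrite le_eqVlt => /predU1P[<- _|t1t].
    by rewrite P1; have [_] := mono _ _ i1 i2 t12; rewrite P1.
  have [+ Pt1] := mono _ _ i1 it' t1t; rewrite P1 mul1r in Pt1 * => Pp.
  rewrite le_eqVlt => /predU1P[<-//|tt2]; split=> //.
  by have [] := mono _ _ it' i2 tt2.
have boost t : t \in `[t1, t2] -> exists x, let A := mdot M (s t) (s t1) in
    let C := - mdot M (s t) x1 in
    [/\ s t = A *: s t1 + C *: x1, x = C *: s t1 + A *: x1, A ^+ 2 - C ^+ 2 = 1,
      0 < A & adapted_frame M (s t) e x].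
  move=> it; have [Pp _ _] := Pt t it; have := PQ t (sub t it).
  have [x [fx Fx]] := fr t (sub t it) => PQt.
  (* Twice this product is the sum of [P t] and its inverse, both positive. *)
  have A0 : 0 < mdot M (s t) (s t1).
    have : 0 < mdot M (s t) (s t1) - mdot M (s t) x1.
      by rewrite -(pmulr_rgt0 _ Pp) PQt.
    by rewrite /P in Pp; lra.
  by exists x; have [] := frame_boost ad1 fx Fx A0.
have i22 : t2 \in `[t1, t2] by rewrite in_itv /= lexx ltW.
have [x2 [s2E x2E AC2 A20 ad2]] := boost t2 i22.
set A2 := mdot M (s t2) (s t1) in s2E x2E AC2 A20.
set C2 := - mdot M (s t2) x1 in s2E x2E AC2.
have [P2p P2le _] := Pt t2 i22.
have P2E : P t2 = A2 - C2 by rewrite /C2 opprK.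
(* If [C2] vanished, [s t2] would equal [s t1], although distinct parameters give distinct
   leaves. *)
have C20 : 0 < C2.
  have C2ge : 0 <= C2 by rewrite P2E in P2le P2p; nra.
  rewrite lt_neqAle C2ge andbT eq_sym; apply/eqP => C2_0.
  have A21 : A2 = 1 by move: AC2; rewrite C2_0; nra.
  apply: (sd t1 t2) => //; first by rewrite lt_eqF.
  by rewrite s2E C2_0 A21 scale1r scale0r addr0.
apply: (crooked_planes_disjoint ad1 ad2 s2E x2E AC2 A20).
apply/normD_lt_signs => e1 e2.
(* Since [e], [s t1] and [s t2] do not vary with [t], each inequality is positivity against one
   fixed vector. *)
rewrite -!mdotZr -!mdotDr; apply: (path_mdot_gt0 hp) => // t it.
have [x [stE xE AC _ ad]] := boost t it.
rewrite !mdotDr !mdotZr; apply: (normD_lt_signs _ _ _).1.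
have [vs vt] := rel_interior_semigroup ad (hdp t (sub t it)).
have [_ Pt1 Pt2] := Pt t it; have [gO _ _] := ad.
apply: (velocity_bound fO gO stE xE s2E AC AC2) => //.
- by rewrite -P2E.
- by rewrite -P2E opprK.
- by rewrite opprK.
Qed.
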